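(* (Soundness of QFUA and QBUA triples.) For all resource functions $P,Q$ and commands $C$: (i) if $\vdash_{\mathsf F}[P]\,C\,[Q]$ is derivable with the QFUA rules, then $\vDash_{\mathsf F}[P]\,C\,[Q]$ holds; (ii) if $\vdash_{\mathsf B}[P]\,C\,[Q]$ is derivable with the QBUA rules, then $\vDash_{\mathsf B}[P]\,C\,[Q]$ holds.
   Context: Commands over integer-valued program variables: $C ::= \mathsf{skip} \mid x:=e \mid \mathsf{assume}(B) \mid \mathsf{tick}(e) \mid C;C \mid C+C \mid C^\star \mid \mathsf{local}\ x\ \mathsf{in}\ C$, where $e$ is an arithmetic expression, $B$ a Boolean expression, $+$ nondeterministic choice, $C^\star$ nondeterministic iteration. States are $\sigma:\mathit{Var}\to\mathbb Z$; $[\![e]\!]_\sigma$ is evaluation. Big-step semantics $\langle C,\sigma,p\rangle\Downarrow_l\langle\tau,q\rangle$ (start in $\sigma$ with resource $p\in\mathbb Z$, end in $\tau$ with resource $q$, $l$ = minimal resource level seen): skip: $\langle\mathsf{skip},\sigma,p\rangle\Downarrow_p\langle\sigma,p\rangle$; assign: $\langle x:=e,\sigma,p\rangle\Downarrow_p\langle\sigma[x\mapsto[\![e]\!]_\sigma],p\rangle$; assume: if $[\![B]\!]_\sigma=\mathsf{true}$ then $\langle\mathsf{assume}(B),\sigma,p\rangle\Downarrow_p\langle\sigma,p\rangle$; tick: $\langle\mathsf{tick}(e),\sigma,p\rangle\Downarrow_{\min(p,p-[\![e]\!]_\sigma)}\langle\sigma,p-[\![e]\!]_\sigma\rangle$;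 seq: from $\langle C_1,\sigma,p\rangle\Downarrow_{l_1}\langle\rho,r\rangle$ and $\langle C_2,\rho,r\rangle\Downarrow_{l_2}\langle\tau,q\rangle$ infer $\langle C_1;C_2,\sigma,p\rangle\Downarrow_{\min(l_1,l_2)}\langle\tau,q\rangle$; choice: any run of $C_1$ or of $C_2$ is a run of $C_1+C_2$ with the same $l$; loop: $\langle C^\star,\sigma,p\rangle\Downarrow_p\langle\sigma,p\rangle$, and any run of $C;C^\star$ is a run of $C^\star$; local: from $\langle C,\sigma,p\rangle\Downarrow_l\langle\tau,q\rangle$ infer $\langle\mathsf{local}\ x\ \mathsf{in}\ C,\sigma[x\mapsto v],p\rangle\Downarrow_l\langle\tau[x\mapsto v],q\rangle$. Write $\langle C,\sigma,p\rangle\Downarrow\langle\tau,q\rangle$ for $\exists l$. Resource functions are $P:\mathit{State}\to\mathbb Z\cup\{\pm\infty\}$. Pointwise $\max(P,Q)$, $\min(P,Q)$, $P+F$, $P-e$; $\mathsf{Sup}\,x.P:=\lambda\sigma.\sup_v P(\sigma[x\mapsto v])$, $\mathsf{Inf}\,x.P:=\lambda\sigma.\inf_v P(\sigma[x\mapsto v])$; $P\preceq Q$ iff $P(\sigma)\le Q(\sigma)$ for all $\sigma$; $[B](\sigma)=+\infty$ if $B$ holds in $\sigma$, else $-\infty$. $\mathrm{fv}$ = free variables, $\mathrm{mod}(C)$ = variables modified by $C$. Semantics: $\vDash_{\mathsf F}[P]C[Q]$ iff for all $\tau$ and $q\ge Q(\tau)$ there exist $\sigma$, $p\ge P(\sigma)$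 with $\langle C,\sigma,p\rangle\Downarrow\langle\tau,q\rangle$. $\vDash_{\mathsf B}[P]C[Q]$ iff for all $\sigma$ and $p\le P(\sigma)$ there exist $\tau$, $q\le Q(\tau)$ with $\langle C,\sigma,p\rangle\Downarrow\langle\tau,q\rangle$. QFUA rules ($\vdash_{\mathsf F}$): $[P]\mathsf{skip}[P]$; $[P]\,x:=e\,[\mathsf{Inf}\,x'.\max(P[x'/x],[x\ne e[x'/x]])]$; $[\max(P,[\neg B])]\mathsf{assume}(B)[\max(P,[\neg B])]$; $[P]\mathsf{tick}(e)[P-e]$; from $[P]C_1[R]$, $[R]C_2[Q]$ get $[P]C_1;C_2[Q]$; from $[P]C_i[Q]$ ($i=1$ or $2$) get $[P]C_1+C_2[Q]$; from $\forall n<k.[P(n)]C[P(n+1)]$ get $[P(0)]C^\star[P(k)]$; from $[P]C[Q]$ get $[\mathsf{Inf}\,x.P]\mathsf{local}\ x\ \mathsf{in}\ C[\mathsf{Inf}\,x.Q]$; from $\forall i\in I.[P_i]C[Q_i]$ get $[\lambda\sigma.\inf_{i\in I}P_i(\sigma)]C[\lambda\sigma.\inf_{i\in I}Q_i(\sigma)]$; if $[P]C[Q]$ and $\mathrm{fv}(B)\cap\mathrm{mod}(C)=\emptyset$ then $[\max(P,[B])]C[\max(Q,[B])]$; if $[P]C[Q]$ and $\mathrm{fv}(F)\cap\mathrm{mod}(C)=\emptyset$ then $[P+F]C[Q+F]$; if $P\preceq P'$, $[P']C[Q']$, $Q'\preceq Q$ then $[P]C[Q]$; if $[P]C[Q]$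 and $y\notin\mathrm{fv}(P)\cup\mathrm{fv}(Q)\cup\mathrm{fv}(C)$ then $[P[y/x]]C[y/x][Q[y/x]]$. QBUA rules ($\vdash_{\mathsf B}$): identical skip, tick, seq, choice, loop, relax, consequence ($P\preceq P'$, $[P']C[Q']$, $Q'\preceq Q$ gives $[P]C[Q]$) and substitution rules, but with: $[P]\,x:=e\,[\mathsf{Sup}\,x'.\min(P[x'/x],[x=e[x'/x]])]$; $[\min(P,[B])]\mathsf{assume}(B)[\min(P,[B])]$; local: $[\mathsf{Sup}\,x.P]\mathsf{local}\ x\ \mathsf{in}\ C[\mathsf{Sup}\,x.Q]$; disjunction: from $\forall i\in I.[P_i]C[Q_i]$ get $[\lambda\sigma.\sup_{i\in I}P_i(\sigma)]C[\lambda\sigma.\sup_{i\in I}Q_i(\sigma)]$; constancy: $[\min(P,[B])]C[\min(Q,[B])]$. *)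

(* Defs.v *)
From mathcomp Require Import all_boot all_order all_algebra.
From mathcomp Require Import boolp classical_sets constructive_ereal.

Set Implicit Arguments.
Unset Strict Implicit.
Unset Printing Implicit Defensive.

Import Order.TTheory GRing.Theory Num.Theory.

Local Open Scope classical_set_scope.
Local Open Scope ring_scope.

(* The set of program variables is countably infinite, so that a fresh
   variable always exists. *)
Definition Var := nat.

Definition state := Var -> int.

Definition upd (T : Type) (f : Var -> T) (x : Var) (v : T) : Var -> T :=
  fun y => if y == x then v else f y.

(* Operators and comparisons are arbitrary functions, so that no particular
   signature of arithmetic or Boolean expressions is imposed. *)
Inductive aexp : Type :=
| AVar of Var
| ACst of int
| AOp of (int -> int -> int) & aexp & aexp.

Inductive bexp : Type :=
| BCst of bool
| BCmp of (int -> int -> bool) & aexp & aexp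
| BNot of bexp
| BAnd of bexp & bexp
| BOr of bexp & bexp.

Fixpoint aeval (e : aexp) (s : state) : int :=
  match e with
  | AVar x => s x
  | ACst n => n
  | AOp f e1 e2 => f (aeval e1 s) (aeval e2 s)
  end.

Fixpoint beval (B : bexp) (s : state) : bool :=
  match B with
  | BCst b => b
  | BCmp r e1 e2 => r (aeval e1 s) (aeval e2 s)
  | BNot B => ~~ beval B s
  | BAnd B1 B2 => beval B1 s && beval B2 s
  | BOr B1 B2 => beval B1 s || beval B2 s
  end.

Fixpoint fva (e : aexp) : seq Var :=
  match e with
  | AVar x => [:: x]
  | ACst _ => [::]
  | AOp _ e1 e2 => fva e1 ++ fva e2
  end.

Fixpoint fvb (B : bexp) : seq Var :=
  match B with
  | BCst _ => [::]
  | BCmp _ e1 e2 => fva e1 ++ fva e2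
  | BNot B => fvb B
  | BAnd B1 B2 | BOr B1 B2 => fvb B1 ++ fvb B2
  end.

Fixpoint arename (r : Var -> Var) (e : aexp) : aexp :=
  match e with
  | AVar x => AVar (r x)
  | ACst n => ACst n
  | AOp f e1 e2 => AOp f (arename r e1) (arename r e2)
  end.

Fixpoint brename (r : Var -> Var) (B : bexp) : bexp :=
  match B with
  | BCst b => BCst b
  | BCmp f e1 e2 => BCmp f (arename r e1) (arename r e2)
  | BNot B => BNot (brename r B)
  | BAnd B1 B2 => BAnd (brename r B1) (brename r B2)
  | BOr B1 B2 => BOr (brename r B1) (brename r B2)
  end.

Inductive cmd : Type :=
| Skip
| Assign of Var & aexp
| Assume of bexp
| Tick of aexp
| Seq of cmd & cmd
| Choice of cmd & cmd
| Star of cmd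
| Local of Var & cmd.

Fixpoint fvc (C : cmd) : seq Var :=
  match C with
  | Skip => [::]
  | Assign x e => x :: fva e
  | Assume B => fvb B
  | Tick e => fva e
  | Seq C1 C2 | Choice C1 C2 => fvc C1 ++ fvc C2
  | Star C => fvc C
  | Local x C => [seq y <- fvc C | y != x]
  end.

Fixpoint modc (C : cmd) : seq Var :=
  match C with
  | Skip | Assume _ | Tick _ => [::]
  | Assign x _ => [:: x]
  | Seq C1 C2 | Choice C1 C2 => modc C1 ++ modc C2
  | Star C => modc C
  | Local x C => [seq y <- modc C | y != x]
  end.

Definition fresh (s : seq Var) : Var := (\max_(x <- s) x).+1.

(* Capture-avoiding simultaneous renaming of the free variables: a bound
   variable is changed only if it would capture a renamed free variable. *)
Fixpoint crename (r : Var -> Var) (C : cmd) : cmd :=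
  match C with
  | Skip => Skip
  | Assign x e => Assign (r x) (arename r e)
  | Assume B => Assume (brename r B)
  | Tick e => Tick (arename r e)
  | Seq C1 C2 => Seq (crename r C1) (crename r C2)
  | Choice C1 C2 => Choice (crename r C1) (crename r C2)
  | Star C => Star (crename r C)
  | Local x C =>
      let s := [seq r y | y <- fvc C & y != x] in
      let z := if x \in s then fresh s else x in
      Local z (crename (upd r x z) C)
  end.

(* e[y/x] and C[y/x] *)
Definition asubst (e : aexp) (y x : Var) : aexp := arename (upd id x y) e.
Definition csubst (C : cmd) (y x : Var) : cmd := crename (upd id x y) C.

(* bigstep C s p l t q is <C, s, p> \Downarrow_l <t, q> *)
Inductive bigstep : cmd -> state -> int -> int -> state -> int -> Prop :=
| bs_skip s p : bigstep Skip s p p s p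
| bs_assign x e s p :
    bigstep (Assign x e) s p p (upd s x (aeval e s)) p
| bs_assume B s p : beval B s = true -> bigstep (Assume B) s p p s p
| bs_tick e s p :
    bigstep (Tick e) s p (Num.min p (p - aeval e s)) s (p - aeval e s)
| bs_seq C1 C2 s p l1 u r l2 t q :
    bigstep C1 s p l1 u r -> bigstep C2 u r l2 t q ->
    bigstep (Seq C1 C2) s p (Num.min l1 l2) t q
| bs_choicel C1 C2 s p l t q :
    bigstep C1 s p l t q -> bigstep (Choice C1 C2) s p l t q
| bs_choicer C1 C2 s p l t q :
    bigstep C2 s p l t q -> bigstep (Choice C1 C2) s p l t q
| bs_star0 C s p : bigstep (Star C) s p p s p
| bs_starS C s p l t q :
    bigstep (Seq C (Star C)) s p l t q -> bigstep (Star C) s p l t q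
| bs_local x C v s p l t q :
    bigstep C s p l t q ->
    bigstep (Local x C) (upd s x v) p l (upd t x v) q.

Definition reaches (C : cmd) (s : state) (p : int) (t : state) (q : int) :=
  exists l, bigstep C s p l t q.

Definition rfun := state -> \bar int.

Definition zsup (A : set (\bar int)) : \bar int := supremum -oo%E A.
Definition zinf (A : set (\bar int)) : \bar int := infimum +oo%E A.

Definition rmax (P Q : rfun) : rfun := fun s => Order.max (P s) (Q s).
Definition rmin (P Q : rfun) : rfun := fun s => Order.min (P s) (Q s).
Definition rsubA (P : rfun) (e : aexp) : rfun :=
  fun s => (P s - (aeval e s)%:E)%E.
Definition rle (P Q : rfun) : Prop := forall s, (P s <= Q s)%E.
Definition rbool (B : bexp) : rfun :=
  fun s => if beval B s then +oo%E else -oo%E.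

(* P + F leaves the sum of opposite infinities to be fixed. The relax rule is
   sound for QFUA only if it is +oo (the convention of [dual_adde]) and for
   QBUA only if it is -oo (the convention of [adde]): with (tick(1))^*, F = +oo,
   resp. F = -oo, refutes the other choice. The two additions agree whenever the
   sum is defined, in particular if F is finite. *)
Definition raddF (P F : rfun) : rfun := fun s => dual_adde (P s) (F s).
Definition raddB (P F : rfun) : rfun := fun s => adde (P s) (F s).

Definition rSup (x : Var) (P : rfun) : rfun :=
  fun s => zsup [set P (upd s x v) | v in [set: int]].
Definition rInf (x : Var) (P : rfun) : rfun :=
  fun s => zinf [set P (upd s x v) | v in [set: int]].

Definition rSupI (I : Type) (P : I -> rfun) : rfun :=
  fun s => zsup [set P i s | i in [set: I]].
Definition rInfI (I : Type) (P : I -> rfun) : rfun :=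
  fun s => zinf [set P i s | i in [set: I]].

(* P[y/x] *)
Definition rsubst (P : rfun) (y x : Var) : rfun := fun s => P (upd s x (s y)).

(* Resource functions are semantic objects: a variable is free in P when the
   value of P depends on it. *)
Definition fvr (P : rfun) : set Var :=
  [set x | exists s v, P (upd s x v) <> P s].

(* The postconditions of the assignment rules,
     Inf x'. max(P[x'/x], [x != e[x'/x]])  and
     Sup x'. min(P[x'/x], [x = e[x'/x]]).
   The bound x' stands for the old value v of x; quantifying over v directly
   makes the rules applicable to every P, even if all of Var is free in P.
   Lemmas [assignF_fresh] and [assignB_fresh] give the displayed forms. *)
Definition assignF (P : rfun) (x : Var) (e : aexp) : rfun :=
  fun s => zinf
    [set Order.max (P (upd s x v))
                   (if s x != aeval e (upd s x v) then +oo%E else -oo%E)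
    | v in [set: int]].
Definition assignB (P : rfun) (x : Var) (e : aexp) : rfun :=
  fun s => zsup
    [set Order.min (P (upd s x v))
                   (if s x == aeval e (upd s x v) then +oo%E else -oo%E)
    | v in [set: int]].

Inductive derivF : rfun -> cmd -> rfun -> Prop :=
| F_skip P : derivF P Skip P
| F_assign P x e : derivF P (Assign x e) (assignF P x e)
| F_assume P B :
    derivF (rmax P (rbool (BNot B))) (Assume B) (rmax P (rbool (BNot B)))
| F_tick P e : derivF P (Tick e) (rsubA P e)
| F_seq P R Q C1 C2 :
    derivF P C1 R -> derivF R C2 Q -> derivF P (Seq C1 C2) Q
| F_choicel P Q C1 C2 : derivF P C1 Q -> derivF P (Choice C1 C2) Q
| F_choicer P Q C1 C2 : derivF P C2 Q -> derivF P (Choice C1 C2) Q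
| F_loop (P : nat -> rfun) k C :
    (forall n, (n < k)%N -> derivF (P n) C (P n.+1)) ->
    derivF (P 0%N) (Star C) (P k)
| F_local P Q x C : derivF P C Q -> derivF (rInf x P) (Local x C) (rInf x Q)
| F_disj (I : Type) (P Q : I -> rfun) C :
    (forall i, derivF (P i) C (Q i)) -> derivF (rInfI P) C (rInfI Q)
| F_constancy P Q B C :
    derivF P C Q -> [set` fvb B] `&` [set` modc C] = set0 ->
    derivF (rmax P (rbool B)) C (rmax Q (rbool B))
| F_relax P Q F C :
    derivF P C Q -> fvr F `&` [set` modc C] = set0 ->
    derivF (raddF P F) C (raddF Q F)
| F_cons P P' Q Q' C :
    rle P P' -> derivF P' C Q' -> rle Q' Q -> derivF P C Q
| F_subst P Q C x y :
    derivF P C Q -> ~ (fvr P `|` fvr Q `|` [set` fvc C]) y ->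
    derivF (rsubst P y x) (csubst C y x) (rsubst Q y x).

Inductive derivB : rfun -> cmd -> rfun -> Prop :=
| B_skip P : derivB P Skip P
| B_assign P x e : derivB P (Assign x e) (assignB P x e)
| B_assume P B : derivB (rmin P (rbool B)) (Assume B) (rmin P (rbool B))
| B_tick P e : derivB P (Tick e) (rsubA P e)
| B_seq P R Q C1 C2 :
    derivB P C1 R -> derivB R C2 Q -> derivB P (Seq C1 C2) Q
| B_choicel P Q C1 C2 : derivB P C1 Q -> derivB P (Choice C1 C2) Q
| B_choicer P Q C1 C2 : derivB P C2 Q -> derivB P (Choice C1 C2) Q
| B_loop (P : nat -> rfun) k C :
    (forall n, (n < k)%N -> derivB (P n) C (P n.+1)) ->
    derivB (P 0%N) (Star C) (P k)
| B_local P Q x C : derivB P C Q -> derivB (rSup x P) (Local x C) (rSup x Q)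
| B_disj (I : Type) (P Q : I -> rfun) C :
    (forall i, derivB (P i) C (Q i)) -> derivB (rSupI P) C (rSupI Q)
| B_constancy P Q B C :
    derivB P C Q -> [set` fvb B] `&` [set` modc C] = set0 ->
    derivB (rmin P (rbool B)) C (rmin Q (rbool B))
| B_relax P Q F C :
    derivB P C Q -> fvr F `&` [set` modc C] = set0 ->
    derivB (raddB P F) C (raddB Q F)
| B_cons P P' Q Q' C :
    rle P P' -> derivB P' C Q' -> rle Q' Q -> derivB P C Q
| B_subst P Q C x y :
    derivB P C Q -> ~ (fvr P `|` fvr Q `|` [set` fvc C]) y ->
    derivB (rsubst P y x) (csubst C y x) (rsubst Q y x).

Definition validF (P : rfun) (C : cmd) (Q : rfun) : Prop :=
  forall (t : state) (q : int), (Q t <= q%:E)%E ->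
  exists (s : state) (p : int), (P s <= p%:E)%E /\ reaches C s p t q.

Definition validB (P : rfun) (C : cmd) (Q : rfun) : Prop :=
  forall (s : state) (p : int), (p%:E <= P s)%E ->
  exists (t : state) (q : int), (q%:E <= Q t)%E /\ reaches C s p t q.

Definition BEq (e1 e2 : aexp) : bexp := BCmp (fun m n => m == n) e1 e2.

Lemma aeval_rename r e (s : state) : aeval (arename r e) s = aeval e (s \o r).
Proof. by elim: e => //= f e1 -> e2 ->. Qed.

Lemma eq_aeval e (s t : state) :
  {in fva e, s =1 t} -> aeval e s = aeval e t.
Proof.
elim: e => [x|n|f e1 IH1 e2 IH2] //= st; first by rewrite st ?inE.
by rewrite IH1 ?IH2 // => x xe; apply: st; rewrite mem_cat xe ?orbT.
Qed.

Section FreshAssign.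
Variables (P : rfun) (x x' : Var) (e : aexp).
Hypotheses (x'x : x' != x) (x'P : ~ fvr P x') (x'e : x' \notin fva e).

Let fresh_subst (s : state) (v : int) : rsubst P x' x (upd s x' v) = P (upd s x v).
Proof.
have -> : rsubst P x' x (upd s x' v) = P (upd (upd s x v) x' v).
  rewrite /rsubst; congr P; apply: funext => y; rewrite /upd eqxx.
  by have [->|//] := eqVneq y x; rewrite eq_sym (negbTE x'x).
by apply: contrapT => ne; apply: x'P; exists (upd s x v), v.
Qed.

Let fresh_aeval (s : state) (v : int) :
  aeval (asubst e x' x) (upd s x' v) = aeval e (upd s x v).
Proof.
rewrite /asubst aeval_rename; apply: eq_aeval => y ye; rewrite /= /upd.
have [_|_] := eqVneq y x; first by rewrite eqxx.
by case: eqVneq => // yx'; move: x'e; rewrite -yx' ye.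
Qed.

Let upd_neq (s : state) (v : int) : upd s x' v x = s x.
Proof. by rewrite /upd eq_sym (negbTE x'x). Qed.

Lemma assignF_fresh :
  rInf x' (rmax (rsubst P x' x) (rbool (BNot (BEq (AVar x) (asubst e x' x)))))
  = assignF P x e.
Proof.
apply: funext => s; congr zinf; apply: eq_imagel => v _.
by rewrite /rmax fresh_subst /rbool /= fresh_aeval upd_neq.
Qed.

Lemma assignB_fresh :
  rSup x' (rmin (rsubst P x' x) (rbool (BEq (AVar x) (asubst e x' x))))
  = assignB P x e.
Proof.
apply: funext => s; congr zsup; apply: eq_imagel => v _.
by rewrite /rmin fresh_subst /rbool /= fresh_aeval upd_neq.
Qed.

End FreshAssign.

(* Main.v *)
From mathcomp Require Import all_boot all_order all_algebra.
From mathcomp Require Import boolp classical_sets constructive_ereal.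
From mathcomp Require Import zify.
Require Import Defs.

(** Soundness is proved rule by rule, by induction on the derivation.  Since
    resources are integers, a finite bound on an infimum (or supremum) is
    already met by one of its members, which handles the assignment, local and
    disjunction rules.  The relax rule translates the resource along the whole
    run and uses that a run changes only the finitely many variables of
    [modc C].  The substitution rule transports a run along a renaming that is
    injective on the free variables of the command. *)

Set Implicit Arguments.
Unset Strict Implicit.
Unset Printing Implicit Defensive.

Import Order.TTheory GRing.Theory Num.Theory.

Local Open Scope classical_set_scope.
Local Open Scope ring_scope.

(** * Suprema and infima of extended integers *)

(** The infinite cases are immediate. Otherwise [A] has a finite member [a] and a finite upper
    bound, and the least upper bound comes from the well-ordering of the naturals. *)
Lemma supremums_neq0 (A : set (\bar int)) : supremums A !=set0.
Proof.
have [Apoo|Apoo] := pselect (A +oo%E).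
  by exists +oo%E; split=> [x _|y]; [rewrite leey|apply].
have [[a Aa]|Afin] := pselect (exists a : int, A a%:E); last first.
  exists -oo%E; split=> [[x| |] Ax|y _]; rewrite ?leNye //.
  by case: Afin; exists x.
have [[b Ab]|Aub] := pselect (exists b : int, ubound A b%:E); last first.
  exists +oo%E; split=> [x _|[y| |] Ay]; rewrite ?leey //.
  - by case: Aub; exists y.
  - by have := Ay _ Aa.
(* Every integer upper bound is [a] plus a natural number, so minimising that offset minimises the
   bound. *)
have ubE (y : int) : ubound A y%:E -> y = a + `|y - a|%N.
  by move=> /(_ _ Aa); rewrite lee_fin; lia.
have exn : exists n : nat, `[< ubound A (a + n%:Z)%:E >].
  by exists `|b - a|%N; apply/asboolP; rewrite -ubE.
have [n /asboolP An n_min] := ex_minnP exn.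
exists (a + n%:Z)%:E; split=> // -[y| |] Ay; rewrite ?leey //; last first.
  by have := Ay _ Aa.
have yE := ubE _ Ay; rewrite lee_fin yE lerD2l lez_nat; apply: n_min.
by apply/asboolP; rewrite -yE.
Qed.

(** The supremum of the lower bounds is the infimum. *)
Lemma infimums_neq0 (A : set (\bar int)) : infimums A !=set0.
Proof.
have [m [mub mleast]] := supremums_neq0 (lbound A).
by exists m; split=> // x Ax; apply: mleast => y; apply.
Qed.

Lemma zsup_ubound (A : set (\bar int)) a : A a -> (a <= zsup A)%E.
Proof. by move=> Aa; apply: ge_supremum_Nmem => //; exact: supremums_neq0. Qed.

Lemma zinf_lbound (A : set (\bar int)) a : A a -> (zinf A <= a)%E.
Proof. by move=> Aa; apply: le_infimum_Nmem => //; exact: infimums_neq0. Qed.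

(** This is where integrality enters: if no member reached [p], then [p - 1] would bound [A], and
    the supremum would lie below [p]. *)
Lemma zsup_attained (A : set (\bar int)) (p : int) :
  (p%:E <= zsup A)%E -> exists2 a, A a & (p%:E <= a)%E.
Proof.
(* For empty [A] the supremum is the default [-oo], which no integer [p] lies below. *)
rewrite /zsup /supremum; case: ifP => [_ //|_].
case: xgetP => [m _ [_ mleast] pm|_ //]; apply: contrapT => noA.
have : (m <= (p - 1)%:E)%E.
  apply: mleast => -[x| |] Ax; rewrite ?leNye //.
    have : ~~ (p <= x) by apply/negP => px; apply: noA; exists x%:E.
    by rewrite lee_fin; lia.
  by case: noA; exists +oo%E; rewrite ?leey.
by move=> /(le_trans pm); rewrite lee_fin; lia.
Qed.

Lemma zinf_attained (A : set (\bar int)) (q : int) :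
  (zinf A <= q%:E)%E -> exists2 a, A a & (a <= q%:E)%E.
Proof.
rewrite /zinf /infimum; case: ifP => [_ //|_].
case: xgetP => [m _ [_ mgreatest] mq|_ //]; apply: contrapT => noA.
have : ((q + 1)%:E <= m)%E.
  apply: mgreatest => -[x| |] Ax; rewrite ?leey //.
    have : ~~ (x <= q) by apply/negP => xq; apply: noA; exists x%:E.
    by rewrite lee_fin; lia.
  by case: noA; exists -oo%E; rewrite ?leNye.
by move=> /le_trans/(_ mq); rewrite lee_fin; lia.
Qed.

(** * Updates and free variables *)

Lemma upd_same (T : Type) (f : Var -> T) x : upd f x (f x) = f.
Proof. by apply: funext => y; rewrite /upd; case: eqP => // ->. Qed.

Lemma upd_upd (T : Type) (f : Var -> T) x v w : upd (upd f x v) x w = upd f x w.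
Proof. by apply: funext => y; rewrite /upd; case: eqP. Qed.

Lemma eq_beval B (s t : state) : {in fvb B, s =1 t} -> beval B s = beval B t.
Proof.
elim: B => [b|r e1 e2|B IH|B1 IH1 B2 IH2|B1 IH1 B2 IH2] //= st.
- by rewrite (@eq_aeval e1 s t) ?(@eq_aeval e2 s t) // => x xe; apply: st;
    rewrite mem_cat xe ?orbT.
- by rewrite IH.
- by rewrite IH1 ?IH2 // => x xe; apply: st; rewrite mem_cat xe ?orbT.
- by rewrite IH1 ?IH2 // => x xe; apply: st; rewrite mem_cat xe ?orbT.
Qed.

Lemma beval_rename r B (s : state) : beval (brename r B) s = beval B (s \o r).
Proof.
by elim: B => [b|f e1 e2|B IH|B1 IH1 B2 IH2|B1 IH1 B2 IH2] //=;
  rewrite ?aeval_rename ?IH ?IH1 ?IH2.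
Qed.

Lemma not_fvr_upd (P : rfun) x s v : ~ fvr P x -> P (upd s x v) = P s.
Proof. by move=> xP; apply: contrapT => ne; apply: xP; exists s, v. Qed.

(** [fvr] only concerns updates of one variable, and a function without free variables may still
    separate states that differ infinitely often. As [xs] is finite, [s] can be turned into [t] by
    one update at a time. *)
Lemma eq_rfun (F : rfun) (xs : seq Var) (s t : state) :
  fvr F `&` [set` xs] = set0 -> (forall x, x \notin xs -> s x = t x) ->
  F s = F t.
Proof.
elim: xs s => [|x xs IH] s Fxs st.
  by congr F; apply: funext => x; exact: st.
have xF : ~ fvr F x.
  by move=> Fx; have : set0 x by rewrite -Fxs; split=> //=; rewrite inE eqxx.
rewrite -(not_fvr_upd s (t x) xF); apply: IH => [|y yxs].
  rewrite -subset0 => y [Fy yxs]; rewrite -Fxs; split=> //=.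
  by rewrite inE [_ \in _]yxs orbT.
by rewrite /upd; case: eqVneq => [->//|yx]; apply: st; rewrite inE negb_or yx.
Qed.

Lemma modc_fvc C : {subset modc C <= fvc C}.
Proof.
elim: C => [|x e|B|e|C1 IH1 C2 IH2|C1 IH1 C2 IH2|C IH|x C IH] y //=.
- by rewrite !inE => ->.
- by rewrite !mem_cat => /orP[/IH1|/IH2] ->; rewrite ?orbT.
- by rewrite !mem_cat => /orP[/IH1|/IH2] ->; rewrite ?orbT.
- exact: IH.
- by rewrite !mem_filter => /andP[-> /IH].
Qed.

Lemma notin_fresh s : fresh s \notin s.
Proof.
apply/negP => fs; have := @leq_bigmax_seq _ s xpredT id _ fs isT.
by rewrite /fresh ltnn.
Qed.

(** * Transformations of runs *)

(** No rule tests the resource, which may be any integer, and [Num.min] commutes with adding [d]. *)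
Lemma bigstep_shift d C s p l t q :
  bigstep C s p l t q -> bigstep C s (p + d) (l + d) t (q + d).
Proof.
elim=> {C s p l t q}.
- by constructor.
- by constructor.
- by constructor.
- by move=> e s p; rewrite addr_minl addrAC; exact: bs_tick.
- by move=> *; rewrite addr_minl; apply: bs_seq; eassumption.
- by move=> *; exact: bs_choicel.
- by move=> *; exact: bs_choicer.
- by constructor.
- by move=> *; exact: bs_starS.
- by move=> *; exact: bs_local.
Qed.

Lemma bigstep_frame C s p l t q :
  bigstep C s p l t q -> forall x, x \notin modc C -> s x = t x.
Proof.
elim=> {C s p l t q} //=.
- by move=> x e s p y; rewrite inE /upd => /negbTE ->.
- move=> C1 C2 s p l1 u r l2 t q _ IH1 _ IH2 x.
  by rewrite mem_cat negb_or => /andP[/IH1-> /IH2].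
- by move=> C1 C2 s p l t q _ IH x; rewrite mem_cat negb_or => /andP[/IH].
- by move=> C1 C2 s p l t q _ IH x; rewrite mem_cat negb_or => /andP[_ /IH].
- by move=> C s p l t q _ IH x xC; apply: IH; rewrite mem_cat negb_or xC.
- move=> x C v s p l t q _ IH y; rewrite mem_filter negb_and negbK /upd.
  by case: eqVneq => //= _ /IH.
Qed.

Lemma bigstep_fvc_frame C s p l t q :
  bigstep C s p l t q -> forall x, x \notin fvc C -> s x = t x.
Proof.
by move=> st x xC; apply: (bigstep_frame st); apply: contra xC; exact: modc_fvc.
Qed.

(** Extends agreement after a subcommand, with free variables [A], to the free variables [D] of the
    whole command. Variables of [D] outside [A] keep their values in the original run, and so do
    their images in the renamed run, since injectivity keeps these apart from the images of [A]. *)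
Lemma eq_rename_sub (A D : seq Var) (f : Var -> Var) (s t s' t' : state) :
  {subset A <= D} -> {in D &, injective f} -> {in D, s' \o f =1 s} ->
  {in A, t' \o f =1 t} -> (forall x, x \notin A -> s x = t x) ->
  (forall w, w \notin [seq f y | y <- A] -> t' w = s' w) ->
  {in D, t' \o f =1 t}.
Proof.
move=> AD finj s's t't st t's' y yD /=.
have [yA|yA] := boolP (y \in A); first exact: t't.
rewrite t's' -?st //; first exact: s's.
by apply: contra yA => /mapP[z zA /finj ->] //; exact: AD.
Qed.

(** The renaming is arbitrary, not a single substitution, because passing under [Local] turns [r]
    into [upd r x z]. The last conclusion, a frame property of the renamed run, is what
    [eq_rename_sub] needs in the compound cases. *)
Lemma bigstep_rename C s p l t q : bigstep C s p l t q ->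
  forall (r : Var -> Var) (s' : state),
  {in fvc C &, injective r} -> {in fvc C, s' \o r =1 s} ->
  exists t', [/\ bigstep (crename r C) s' p l t' q, {in fvc C, t' \o r =1 t} &
    forall w, w \notin [seq r y | y <- fvc C] -> t' w = s' w].
Proof.
elim=> {C s p l t q} /=.
- by move=> s p r s' _ _; exists s'; split=> //; exact: bs_skip.
- move=> x e s p r s' rinj s's.
  exists (upd s' (r x) (aeval (arename r e) s')); split.
  + exact: bs_assign.
  + move=> y yC /=; rewrite /upd.
    have [->|yx] := eqVneq y x.
      rewrite eqxx aeval_rename; apply: eq_aeval => z ze.
      by apply: s's; rewrite inE ze orbT.
    case: eqVneq => [/rinj yxE|_]; last exact: s's.
    by rewrite yxE ?eqxx ?inE ?eqxx // in yx.
  + by move=> w; rewrite inE negb_or /upd => /andP[/negbTE-> _].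
- move=> B s p Bs r s' rinj s's; exists s'; split=> //.
  by apply: bs_assume; rewrite beval_rename (eq_beval s's).
- move=> e s p r s' rinj s's; exists s'; split=> //.
  by rewrite -(eq_aeval s's) -aeval_rename; exact: bs_tick.
- move=> C1 C2 s p l1 u r l2 t q b1 IH1 b2 IH2 f s' finj s's.
  have C1C y : y \in fvc C1 -> y \in fvc C1 ++ fvc C2.
    by rewrite mem_cat => ->.
  have C2C y : y \in fvc C2 -> y \in fvc C1 ++ fvc C2.
    by rewrite mem_cat orbC => ->.
  have [u' [b1' u'u u's']] := IH1 f s' (sub_in2 C1C finj) (sub_in1 C1C s's).
  have u'_on : {in fvc C1 ++ fvc C2, u' \o f =1 u}.
    exact: eq_rename_sub C1C finj s's u'u (bigstep_fvc_frame b1) u's'.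
  have [t' [b2' t't t'u']] := IH2 f u' (sub_in2 C2C finj) (sub_in1 C2C u'_on).
  exists t'; split; first exact: bs_seq b1' b2'.
    exact: eq_rename_sub C2C finj u'_on t't (bigstep_fvc_frame b2) t'u'.
  move=> w; rewrite map_cat mem_cat negb_or => /andP[w1 w2].
  by rewrite t'u' // u's'.
- move=> C1 C2 s p l t q b IH f s' finj s's.
  have C1C y : y \in fvc C1 -> y \in fvc C1 ++ fvc C2.
    by rewrite mem_cat => ->.
  have [t' [b' t't t's']] := IH f s' (sub_in2 C1C finj) (sub_in1 C1C s's).
  exists t'; split; first exact: bs_choicel.
    exact: eq_rename_sub C1C finj s's t't (bigstep_fvc_frame b) t's'.
  by move=> w; rewrite map_cat mem_cat negb_or => /andP[/t's'].
- move=> C1 C2 s p l t q b IH f s' finj s's.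
  have C2C y : y \in fvc C2 -> y \in fvc C1 ++ fvc C2.
    by rewrite mem_cat orbC => ->.
  have [t' [b' t't t's']] := IH f s' (sub_in2 C2C finj) (sub_in1 C2C s's).
  exists t'; split; first exact: bs_choicer.
    exact: eq_rename_sub C2C finj s's t't (bigstep_fvc_frame b) t's'.
  by move=> w; rewrite map_cat mem_cat negb_or => /andP[_ /t's'].
- by move=> C s p r s' _ s's; exists s'; split=> //; exact: bs_star0.
- move=> C s p l t q b IH f s' finj s's.
  have CC y : y \in fvc C ++ fvc C -> y \in fvc C by rewrite mem_cat orbb.
  have [t' [b' t't t's']] := IH f s' (sub_in2 CC finj) (sub_in1 CC s's).
  exists t'; split; first exact: bs_starS.
    by move=> y yC; apply: t't; rewrite mem_cat yC.
  by move=> w wC; apply: t's'; rewrite map_cat mem_cat negb_or wC.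
- move=> x C v s p l t q b IH f s' finj s's.
  set fx := [seq f y | y <- fvc C & y != x].
  (* The bound variable chosen by [crename]; in both cases it avoids the images of the other free
     variables of the body, so the updated renaming stays injective. *)
  set z := if x \in fx then fresh fx else x.
  have zfx : z \notin fx.
    by rewrite /z; case: ifPn => // _; exact: notin_fresh.
  have fz y : y \in fvc C -> y != x -> f y != z.
    move=> yC yx; apply: contra zfx => /eqP <-.
    by apply: map_f; rewrite mem_filter yx.
  have finj' : {in fvc C &, injective (upd f x z)}.
    move=> y1 y2 y1C y2C; rewrite /upd.
    case: (eqVneq y1 x) => [->|y1x]; case: (eqVneq y2 x) => [->|y2x] //.
    - by move=> /esym/eqP; rewrite (negbTE (fz _ _ _)).
    - by move=> /eqP; rewrite (negbTE (fz _ _ _)).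
    - by apply: finj; rewrite mem_filter ?y1x ?y2x.
  (* The renamed body starts with [z] holding [s x], the inner initial value of [x]. *)
  have s's' : {in fvc C, upd s' z (s x) \o upd f x z =1 s}.
    move=> y yC; rewrite /= /upd; have [->|yx] := eqVneq y x.
      by rewrite eqxx.
    rewrite (negbTE (fz _ yC yx)); have := s's y.
    by rewrite mem_filter yx yC /= /upd (negbTE yx) => ->.
  have [t' [b' t't t's']] := IH _ _ finj' s's'.
  (* The local rule is applied with outer value [s' z]: resetting [z] to it gives back [s'] at the
     start and this state at the end. *)
  exists (upd t' z (s' z)); split.
  + by rewrite -{1}(upd_same s' z) -(upd_upd s' z (s x)); exact: bs_local.
  + move=> y; rewrite mem_filter => /andP[yx yC] /=.
    rewrite /upd (negbTE (fz _ yC yx)) (negbTE yx) -t't //=.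
    by rewrite /upd (negbTE yx).
  + move=> w wfx; rewrite /upd; have [->//|wz] := eqVneq w z.
    rewrite t's' /upd ?(negbTE wz) //; apply: contra wfx => /mapP[y yC].
    have [_ wE|yx ->] := eqVneq y x; first by rewrite wE eqxx in wz.
    by apply: map_f; rewrite mem_filter yx.
Qed.

Lemma reaches_shift d C s p t q :
  reaches C s p t q -> reaches C s (p + d) t (q + d).
Proof. by move=> [l st]; exists (l + d); exact: bigstep_shift. Qed.

Lemma reaches_frame C s p t q :
  reaches C s p t q -> forall x, x \notin modc C -> s x = t x.
Proof. by move=> [l]; exact: bigstep_frame. Qed.

Lemma reaches_beval B C s p t q :
  [set` fvb B] `&` [set` modc C] = set0 -> reaches C s p t q ->
  beval B s = beval B t.
Proof.
move=> BC st; apply: eq_beval => x xB; apply: (reaches_frame st).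
by apply/negP => xC; have : set0 x by rewrite -BC.
Qed.

Lemma reaches_rfun (F : rfun) C s p t q :
  fvr F `&` [set` modc C] = set0 -> reaches C s p t q -> F s = F t.
Proof. by move=> FC st; apply: eq_rfun FC (reaches_frame st). Qed.

Lemma reaches_local x C s p t q w :
  reaches C s p t q -> reaches (Local x C) (upd s x w) p (upd t x w) q.
Proof. by move=> [l st]; exists l; exact: bs_local. Qed.

Lemma reaches_starS C s p u r t q :
  reaches C s p u r -> reaches (Star C) u r t q -> reaches (Star C) s p t q.
Proof.
move=> [l1 b1] [l2 b2]; exists (Num.min l1 l2).
by apply: bs_starS; exact: bs_seq b1 b2.
Qed.

Lemma reaches_rename (r : Var -> Var) (s' : state) C s p t q :
  reaches C s p t q ->
  {in fvc C &, injective r} -> {in fvc C, s' \o r =1 s} ->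
  exists t', [/\ reaches (crename r C) s' p t' q, {in fvc C, t' \o r =1 t} &
    forall w, w \notin [seq r y | y <- fvc C] -> t' w = s' w].
Proof.
move=> [l st] rinj s's; have [t' [st' t't t's']] := bigstep_rename st rinj s's.
by exists t'; split=> //; exists l.
Qed.

(** * Substitution of a variable that is not free in the command *)

Lemma upd_id_inj (C : cmd) x y :
  y \notin fvc C -> {in fvc C &, injective (upd id x y)}.
Proof.
move=> yC u w uC wC; rewrite /upd.
case: (eqVneq u x) => [->|ux]; case: (eqVneq w x) => [->|wx] //=.
- by move=> yw; rewrite yw wC in yC.
- by move=> uy; rewrite -uy uC in yC.
Qed.

(** Serves the forward rule, where the end state [t] is prescribed. In the start state [y] takes
    over the role of [x] and so holds [s x], while [x], no longer free in the substituted command,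
    must already hold its final value [t x]. *)
Lemma reaches_csubst_pre C x y s p t q :
  y \notin fvc C -> reaches C s p (upd t x (t y)) q ->
  reaches (csubst C y x) (upd (upd s y (s x)) x (t x)) p t q.
Proof.
move=> yC st; set s' := upd _ x _.
have frame w : w \notin fvc C -> s w = upd t x (t y) w.
  by case: st => l st; exact: (bigstep_fvc_frame st).
have s's : {in fvc C, s' \o upd id x y =1 s}.
  move=> w wC; rewrite /= /s' /upd; have [->|wx] := eqVneq w x.
    case: (eqVneq y x) => [yx|]; rewrite ?eqxx //.
    by rewrite frame -?yx // /upd eqxx.
  by rewrite (negbTE wx); case: eqVneq => // wy; rewrite -wy wC in yC.
have [t' [st' t't t's']] := reaches_rename st (upd_id_inj yC) s's.
suff <- : t' = t by [].
apply: funext => w.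
have [/mapP[u uC ->]|wC] := boolP (w \in map (upd id x y) (fvc C)).
  by rewrite [LHS]t't // /upd; case: eqVneq.
rewrite t's' // /s' /upd; have [->//|wx] := eqVneq w x.
have wC' : w \notin fvc C.
  apply: contra wC => wC; apply/mapP; exists w => //.
  by rewrite /upd (negbTE wx).
(* If [y] is not an image, then [x] is not free in [C]; the original run leaves [x] alone, whence
   [s x = t y]. *)
have [wy|wy] := eqVneq w y; last by rewrite frame // /upd (negbTE wx).
have xC : x \notin fvc C.
  by apply: contra wC => xC; apply/mapP; exists x; rewrite // /upd eqxx.
by rewrite frame // /upd eqxx wy.
Qed.

(** Serves the backward rule, where the start state [s] is prescribed. The end states need only
    correspond up to the value of [y], since [y] is not free in the postcondition. *)
Lemma reaches_csubst_post C x y s p t q :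
  y \notin fvc C -> reaches C (upd s x (s y)) p t q ->
  exists t', reaches (csubst C y x) s p t' q /\
    exists v, upd t' x (t' y) = upd t y v.
Proof.
move=> yC st.
have frame w : w \notin fvc C -> upd s x (s y) w = t w.
  by case: st => l st; exact: (bigstep_fvc_frame st).
have s's : {in fvc C, s \o upd id x y =1 upd s x (s y)}.
  by move=> w wC; rewrite /= /upd; case: eqVneq.
have [t' [st' t't t's']] := reaches_rename st (upd_id_inj yC) s's.
exists t'; split=> //; exists (upd t' x (t' y) y); apply: funext => w.
rewrite [RHS]/upd; have [->//|wy] := eqVneq w y.
rewrite /upd; have [->|wx] := eqVneq w x.
  (* If [x] is free in [C], its renamed copy is [y]. If not, neither [x] in the original run nor [y]
     in the renamed one is changed, and both hold [s y]. *)
  have [xC|xC] := boolP (x \in fvc C).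
    by rewrite -t't //= /upd eqxx.
  rewrite -frame // t's' /upd ?eqxx //; apply: contra xC => /mapP[u uC].
  case: eqVneq => [<- //|_ yu]; by rewrite yu uC in yC.
have [wC|wC] := boolP (w \in fvc C).
  by rewrite -t't //= /upd (negbTE wx).
rewrite -frame // t's' /upd ?(negbTE wx) //; apply: contra wC => /mapP[u uC].
case: (eqVneq u x) => [_ wyE|_ -> //]; by rewrite wyE eqxx in wy.
Qed.

(** * Soundness of the forward rules *)

Lemma validF_assign P x e : validF P (Assign x e) (assignF P x e).
Proof.
move=> t q /zinf_attained[_ [v _ <-]]; rewrite ge_max => /andP[Pq].
(* A finite bound excludes the value [+oo] of the bracket, so [t x] is the value of [e] at the old
   state [upd t x v]. *)
case: eqVneq => [te _|//].
exists (upd t x v), q; split=> //; exists q.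
by have := bs_assign x e (upd t x v) q; rewrite -te upd_upd upd_same.
Qed.

Lemma validF_assume P B :
  validF (rmax P (rbool (BNot B))) (Assume B) (rmax P (rbool (BNot B))).
Proof.
move=> t q Pq; exists t, q; split=> //; exists q; apply: bs_assume.
by move: Pq; rewrite /rmax /rbool /= ge_max; case: beval => //; rewrite andbF.
Qed.

Lemma validF_tick P e : validF P (Tick e) (rsubA P e).
Proof.
move=> t q; rewrite /rsubA leeBlDr // => Pq.
exists t, (q + aeval e t); split=> //.
by have := bs_tick e t (q + aeval e t); rewrite addrK; eexists; eassumption.
Qed.

Lemma validF_seq P R Q C1 C2 :
  validF P C1 R -> validF R C2 Q -> validF P (Seq C1 C2) Q.
Proof.
move=> V1 V2 t q /V2[u [r [/V1[s [p [Pp [l1 b1]]]] [l2 b2]]]].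
by exists s, p; split=> //; exists (Num.min l1 l2); exact: bs_seq b1 b2.
Qed.

Lemma validF_loop (P : nat -> rfun) k C :
  (forall n, (n < k)%N -> validF (P n) C (P n.+1)) ->
  validF (P 0%N) (Star C) (P k).
Proof.
elim: k P => [|k IH] P V t q Pq.
  by exists t, q; split=> //; exists q; exact: bs_star0.
have V' n : (n < k)%N -> validF (P n.+1) C (P n.+2) by move=> nk; exact: V.
(* The shifted family covers all iterations but the first, which [V] at index 0 then supplies. *)
have [u [r [/V[//|s [p [Pp b1]]] b2]]] := IH (fun n => P n.+1) V' t q Pq.
by exists s, p; split=> //; exact: reaches_starS b1 b2.
Qed.

Lemma validF_local P Q x C :
  validF P C Q -> validF (rInf x P) (Local x C) (rInf x Q).
Proof.
move=> V t q /zinf_attained[_ [v _ <-] /V[s [p [Pp st]]]].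
(* [v] is the final inner value of [x]; its outer value [t x] is the same before and after the
   block. *)
exists (upd s x (t x)), p; split.
  apply: le_trans Pp; apply: zinf_lbound; exists (s x) => //.
  by rewrite upd_upd upd_same.
by rewrite -{2}(upd_same t x) -(upd_upd t x v); exact: reaches_local.
Qed.

Lemma validF_disj (I : Type) (P Q : I -> rfun) C :
  (forall i, validF (P i) C (Q i)) -> validF (rInfI P) C (rInfI Q).
Proof.
move=> V t q /zinf_attained[_ [i _ <-] /V[s [p [Pp st]]]].
exists s, p; split=> //; apply: le_trans Pp.
by apply: zinf_lbound; exists i.
Qed.

Lemma validF_constancy P Q B C :
  validF P C Q -> [set` fvb B] `&` [set` modc C] = set0 ->
  validF (rmax P (rbool B)) C (rmax Q (rbool B)).
Proof.
move=> V BC t q; rewrite /rmax ge_max => /andP[/V[s [p [Pp st]]] Bt].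
exists s, p; split=> //; rewrite ge_max Pp /=.
by move: Bt; rewrite /rbool (reaches_beval BC st); case: beval; rewrite ?leNye.
Qed.

Lemma validF_relax P Q F C :
  validF P C Q -> fvr F `&` [set` modc C] = set0 ->
  validF (raddF P F) C (raddF Q F).
Proof.
move=> V FC t q; rewrite /raddF; case Ft: (F t) => [f| |].
(* For a finite frame value [f], the run is translated by [f]. *)
- move=> Qq; have /V[s [p [Pp st]]] : (Q t <= (q - f)%:E)%E.
    move: Qq; case: (Q t) => [a| |] //; last by move=> _; rewrite leNye.
    by rewrite /dual_adde /= !lee_fin lerBrDr.
  exists s, (p + f); split; last by rewrite -[q](subrK f); exact: reaches_shift.
  rewrite (reaches_rfun FC st) Ft; move: Pp.
  case: (P s) => [a| |] //; last by move=> _; rewrite leNye.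
  by rewrite /dual_adde /= !lee_fin lerD2r.
(* With [F t = +oo] the dual sum is always [+oo], so no integer [q] bounds it. *)
- by case: (Q t).
(* With [F t = -oo] the dual sum is [+oo] only if [Q t] is, so [Q t] has some integer bound [q'].
   The run ending at [q'] is translated to end at [q]; its precondition is [-oo], because [P s <= p]
   rules out [+oo]. *)
- move=> Qq; have [q' /V[s [p [Pp st]]]] : exists q' : int, (Q t <= q'%:E)%E.
    by move: Qq; case: (Q t) => [a| |] // _; [exists a|exists 0].
  exists s, (p + (q - q')); split.
    by rewrite (reaches_rfun FC st) Ft; move: Pp;
      case: (P s) => // *; exact: leNye.
  by rewrite -{2}[q](subrKC q'); exact: reaches_shift.
Qed.

Lemma validF_subst P Q C x y :
  validF P C Q -> ~ (fvr P `|` fvr Q `|` [set` fvc C]) y ->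
  validF (rsubst P y x) (csubst C y x) (rsubst Q y x).
Proof.
move=> V yfv t q /V[s [p [Pp st]]].
have yC : y \notin fvc C by apply/negP => yC; apply: yfv; right.
have yP : ~ fvr P y by move=> yP; apply: yfv; left; left.
exists (upd (upd s y (s x)) x (t x)), p; split; last exact: reaches_csubst_pre.
(* Copying [y] into [x] in the chosen start gives back [s] except at [y], on which [P] does not
   depend. *)
rewrite /rsubst upd_upd; suff [v ->] : exists v, upd (upd s y (s x)) x
    (upd (upd s y (s x)) x (t x) y) = upd s y v by rewrite not_fvr_upd.
have [->|yx] := eqVneq y x; first by eexists; rewrite upd_upd.
exists (s x); apply: funext => w; rewrite /upd eqxx (negbTE yx).
by have [->|] := eqVneq w x; rewrite // eq_sym (negbTE yx).
Qed.

Lemma derivF_sound P C Q : derivF P C Q -> validF P C Q.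
Proof.
elim=> {P C Q}.
- by move=> P t q Pq; exists t, q; split=> //; exists q; exact: bs_skip.
- exact: validF_assign.
- exact: validF_assume.
- exact: validF_tick.
- by move=> P R Q C1 C2 _ V1 _; exact: validF_seq.
- move=> P Q C1 C2 _ V t q /V[s [p [Pp [l st]]]].
  by exists s, p; split=> //; exists l; exact: bs_choicel.
- move=> P Q C1 C2 _ V t q /V[s [p [Pp [l st]]]].
  by exists s, p; split=> //; exists l; exact: bs_choicer.
- by move=> P k C _; exact: validF_loop.
- by move=> P Q x C _; exact: validF_local.
- by move=> I P Q C _; exact: validF_disj.
- by move=> P Q B C _; exact: validF_constancy.
- by move=> P Q F C _; exact: validF_relax.
- move=> P P' Q Q' C PP' _ V Q'Q t q Qq.
  have /V[s [p [Pp st]]] := le_trans (Q'Q t) Qq.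
  by exists s, p; split=> //; exact: le_trans (PP' s) Pp.
- by move=> P Q C x y _; exact: validF_subst.
Qed.

(** * Soundness of the backward rules *)

Lemma validB_assign P x e : validB P (Assign x e) (assignB P x e).
Proof.
move=> s p Pp; exists (upd s x (aeval e s)), p.
split; last by exists p; exact: bs_assign.
(* The old value [s x] makes the equality bracket [+oo], so the minimum is [P s]. *)
apply: le_trans Pp _; apply: zsup_ubound; exists (s x) => //.
by rewrite upd_upd upd_same /upd eqxx eqxx minEle leey.
Qed.

Lemma validB_assume P B :
  validB (rmin P (rbool B)) (Assume B) (rmin P (rbool B)).
Proof.
move=> s p Pp; exists s, p; split=> //; exists p; apply: bs_assume.
by move: Pp; rewrite /rmin /rbool le_min; case: beval => //; rewrite andbF.
Qed.

Lemma validB_tick P e : validB P (Tick e) (rsubA P e).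
Proof.
move=> s p Pp; exists s, (p - aeval e s).
split; last by eexists; exact: bs_tick.
by rewrite /rsubA leeBrDr // -EFinD subrK.
Qed.

Lemma validB_seq P R Q C1 C2 :
  validB P C1 R -> validB R C2 Q -> validB P (Seq C1 C2) Q.
Proof.
move=> V1 V2 s p /V1[u [r [/V2[t [q [Qq [l2 b2]]]] [l1 b1]]]].
by exists t, q; split=> //; exists (Num.min l1 l2); exact: bs_seq b1 b2.
Qed.

Lemma validB_loop (P : nat -> rfun) k C :
  (forall n, (n < k)%N -> validB (P n) C (P n.+1)) ->
  validB (P 0%N) (Star C) (P k).
Proof.
elim: k P => [|k IH] P V s p Pp.
  by exists s, p; split=> //; exists p; exact: bs_star0.
have V' n : (n < k)%N -> validB (P n.+1) C (P n.+2) by move=> nk; exact: V.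
have [//|u [r [Pr b1]]] := V 0%N _ s p Pp.
have [t [q [Pq b2]]] := IH (fun n => P n.+1) V' u r Pr.
by exists t, q; split=> //; exact: reaches_starS b1 b2.
Qed.

Lemma validB_local P Q x C :
  validB P C Q -> validB (rSup x P) (Local x C) (rSup x Q).
Proof.
move=> V s p /zsup_attained[_ [v _ <-] /V[t [q [Qq st]]]].
exists (upd t x (s x)), q; split.
  apply: le_trans Qq _; apply: zsup_ubound; exists (t x) => //.
  by rewrite upd_upd upd_same.
by rewrite -{1}(upd_same s x) -(upd_upd s x v); exact: reaches_local.
Qed.

Lemma validB_disj (I : Type) (P Q : I -> rfun) C :
  (forall i, validB (P i) C (Q i)) -> validB (rSupI P) C (rSupI Q).
Proof.
move=> V s p /zsup_attained[_ [i _ <-] /V[t [q [Qq st]]]].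
exists t, q; split=> //; apply: le_trans Qq _.
by apply: zsup_ubound; exists i.
Qed.

Lemma validB_constancy P Q B C :
  validB P C Q -> [set` fvb B] `&` [set` modc C] = set0 ->
  validB (rmin P (rbool B)) C (rmin Q (rbool B)).
Proof.
move=> V BC s p; rewrite /rmin le_min => /andP[/V[t [q [Qq st]]] Bs].
exists t, q; split=> //; rewrite le_min Qq /=.
by move: Bs; rewrite /rbool (reaches_beval BC st); case: beval; rewrite ?leey.
Qed.

Lemma validB_relax P Q F C :
  validB P C Q -> fvr F `&` [set` modc C] = set0 ->
  validB (raddB P F) C (raddB Q F).
Proof.
move=> V FC s p; rewrite /raddB; case Fs: (F s) => [f| |].
- move=> Pp; have /V[t [q [Qq st]]] : ((p - f)%:E <= P s)%E.
    move: Pp; case: (P s) => [a| |] //; last by move=> _; rewrite leey.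
    by rewrite /= !lee_fin lerBlDr.
  exists t, (q + f); split; last by rewrite -[p](subrK f); exact: reaches_shift.
  rewrite -(reaches_rfun FC st) Fs; move: Qq.
  case: (Q t) => [a| |] //; last by move=> _; rewrite leey.
  by rewrite /= !lee_fin lerD2r.
(* With [F s = +oo] the sum is [-oo] only if [P s] is, so some integer [p'] lies below [P s]. The
   run from [p'] is translated to start at [p], and its postcondition is [+oo] since [Q t] is not
   [-oo]. *)
- move=> Pp; have [p' /V[t [q [Qq st]]]] : exists p' : int, (p'%:E <= P s)%E.
    by move: Pp; case: (P s) => [a| |] // _; [exists a|exists 0].
  exists t, (q + (p - p')); split.
    by rewrite -(reaches_rfun FC st) Fs; move: Qq;
      case: (Q t) => // *; exact: leey.
  by rewrite -{1}[p](subrKC p'); exact: reaches_shift.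
- by case: (P s).
Qed.

Lemma validB_subst P Q C x y :
  validB P C Q -> ~ (fvr P `|` fvr Q `|` [set` fvc C]) y ->
  validB (rsubst P y x) (csubst C y x) (rsubst Q y x).
Proof.
move=> V yfv s p /V[t [q [Qq st]]].
have yC : y \notin fvc C by apply/negP => yC; apply: yfv; right.
have yQ : ~ fvr Q y by move=> yQ; apply: yfv; left; right.
have [t' [st' [v t'E]]] := reaches_csubst_post yC st.
by exists t', q; split=> //; rewrite /rsubst t'E not_fvr_upd.
Qed.

Lemma derivB_sound P C Q : derivB P C Q -> validB P C Q.
Proof.
elim=> {P C Q}.
- by move=> P s p Pp; exists s, p; split=> //; exists p; exact: bs_skip.
- exact: validB_assign.
- exact: validB_assume.
- exact: validB_tick.
- by move=> P R Q C1 C2 _ V1 _; exact: validB_seq.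
- move=> P Q C1 C2 _ V s p /V[t [q [Qq [l st]]]].
  by exists t, q; split=> //; exists l; exact: bs_choicel.
- move=> P Q C1 C2 _ V s p /V[t [q [Qq [l st]]]].
  by exists t, q; split=> //; exists l; exact: bs_choicer.
- by move=> P k C _; exact: validB_loop.
- by move=> P Q x C _; exact: validB_local.
- by move=> I P Q C _; exact: validB_disj.
- by move=> P Q B C _; exact: validB_constancy.
- by move=> P Q F C _; exact: validB_relax.
- move=> P P' Q Q' C PP' _ V Q'Q s p Pp.
  have /V[t [q [Qq st]]] := le_trans Pp (PP' s).
  by exists t, q; split=> //; exact: le_trans Qq (Q'Q t).
- by move=> P Q C x y _; exact: validB_subst.
Qed.

Theorem theorem1 (P Q : rfun) (C : cmd) :
  (derivF P C Q -> validF P C Q) /\ (derivB P C Q -> validB P C Q).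
Proof. by split; [exact: derivF_sound|exact: derivB_sound]. Qed.
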